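(* Let $E$ and $F$ be Banach lattices and assume that $E$ has order continuous norm. Let $T:E\to F$ be a linear disjointness preserving operator, and let $E_T$ be the ideal of $E$ described in the context. Then $T=R+S$, where $R:E\to F$ is a norm bounded disjointness preserving linear operator with $R=T$ on $E_T$, and $S:E\to F$ is a disjointness preserving linear operator with $S=0$ on $E_T$. Moreover, $R$ and $S$ are uniquely determined by these properties.
   Context: Elements $x,y$ of a Banach lattice are disjoint, $x\perp y$, if $|x|\wedge|y|=0$. A linear operator (not assumed continuous) between Riesz spaces is disjointness preserving if it maps disjoint elements to disjoint elements. An ideal of $E$ is a (not necessarily closed) linear subspace $I$ such that $|y|\le|x|$, $x\in I$ implies $y\in I$; it is order dense if $I^d=\{y\in E:y\perp x\text{ for all }x\in I\}=\{0\}$. For $0\le u\in E$, $A_u=\{y\in E:|y|\le\lambda u\text{ for some }\lambda\ge0\}$ is the principal ideal generated by $u$. The norm of $E$ is order continuous if $x_\alpha\downarrow 0$ implies $\|x_\alpha\|\to 0$. Definition of $E_T$: fix a maximal set $\mathcal{U}$ of pairwise disjoint elements $0<u\in E$ such that the restriction $T|_{A_u}$ is bounded with respect to the norm of $E$ on $A_u$; $E_T$ is the ideal of $E$ generated by $\mathcal{U}$. (It is an order dense ideal on which $T$ is norm bounded.) *)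

(* Defs.v *)
From HB Require Import structures.
From mathcomp Require Import all_boot all_order all_algebra.
From mathcomp Require Import all_classical all_reals all_analysis.

Set Implicit Arguments.
Unset Strict Implicit.
Unset Printing Implicit Defensive.

Import Order.TTheory GRing.Theory Num.Theory.
Import numFieldNormedType.Exports.

Local Open Scope classical_set_scope.
Local Open Scope ring_scope.

(* [Hierarchy-Builder] rejects any structure joining an order of [Order] with a
   normed module, because [Num.NumDomain] is already such a join.  The order of a
   Riesz space is therefore carried by the mixin; [riesz_order E] below is the
   same type equipped with the corresponding [latticeType] structure. *)
HB.mixin Record Lmodule_isRiesz (R : numDomainType) E of GRing.Lmodule R E := {
  riesz_le : rel E ;
  riesz_join : E -> E -> E ;
  riesz_meet : E -> E -> E ;
  riesz_le_refl : reflexive riesz_le ;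
  riesz_le_anti : antisymmetric riesz_le ;
  riesz_le_trans : transitive riesz_le ;
  riesz_leUx : forall x y z : E,
    riesz_le (riesz_join x y) z = riesz_le x z && riesz_le y z ;
  riesz_lexI : forall x y z : E,
    riesz_le x (riesz_meet y z) = riesz_le x y && riesz_le x z ;
  riesz_leD : forall x y z : E, riesz_le x y -> riesz_le (x + z) (y + z) ;
  riesz_scale_ge0 : forall (a : R) (x : E),
    0 <= a -> riesz_le 0 x -> riesz_le 0 (a *: x)
}.

#[short(type="rieszType")]
HB.structure Definition Riesz (R : numDomainType) :=
  {E of Lmodule_isRiesz R E & GRing.Lmodule R E}.

Reserved Notation "x <=v y" (at level 70, no associativity).
Notation "x <=v y" := (riesz_le x y) : ring_scope.

Fact riesz_display : Order.disp_t. Proof. exact: Order.Disp tt tt. Qed.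

Definition riesz_order (R : numDomainType) (E : rieszType R) : Type := E.

Section RieszOrder.
Context {R : numDomainType} {E : rieszType R}.

HB.instance Definition _ := Choice.copy (riesz_order E) E.
HB.instance Definition _ := Order.Le_isPOrder.Build riesz_display
  (riesz_order E) (@riesz_le_refl R E) (@riesz_le_anti R E)
  (@riesz_le_trans R E).
HB.instance Definition _ := Order.POrder_isMeetSemilattice.Build riesz_display
  (riesz_order E) (@riesz_lexI R E).
HB.instance Definition _ := Order.POrder_isJoinSemilattice.Build riesz_display
  (riesz_order E) (@riesz_leUx R E).

End RieszOrder.

(* The lattice modulus; the notation [`|x|] is reserved for the norm. *)
Definition modulus (R : numDomainType) (E : rieszType R) (x : E) : E :=
  riesz_join x (- x).

HB.mixin Record Riesz_isBanachLattice (R : realType) E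
    of CompleteNormedModule R E & Riesz R E := {
  norm_solid : forall x y : E, modulus x <=v modulus y -> `|x| <= `|y|
}.

#[short(type="banachLatticeType")]
HB.structure Definition BanachLattice (R : realType) :=
  {E of Riesz_isBanachLattice R E & CompleteNormedModule R E & Riesz R E}.

Section RieszSpaces.
Context {R : numDomainType}.
Implicit Types E F : rieszType R.

Definition disjoint_elts E (x y : E) : Prop :=
  riesz_meet (modulus x) (modulus y) = 0.

Definition disjointness_preserving E F (T : E -> F) : Prop :=
  forall x y : E, disjoint_elts x y -> disjoint_elts (T x) (T y).

Definition is_ideal E (I : set E) : Prop :=
  [/\ I 0,
      forall (a : R) (x y : E), I x -> I y -> I (a *: x + y)
    & forall x y : E, modulus y <=v modulus x -> I x -> I y].

Definition generated_ideal E (U : set E) : set E := smallest (@is_ideal E) U.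

Definition principal_ideal E (u : E) : set E :=
  [set y | exists2 a : R, 0 <= a & modulus y <=v a *: u].

(* [x] decreases along the preorder [le] and has infimum 0. *)
Definition decreasing_to0 E (A : Type) (le : A -> A -> Prop) (x : A -> E) :
    Prop :=
  [/\ forall a b, le a b -> x b <=v x a,
      forall a, 0 <=v x a
    & forall y : E, (forall a, y <=v x a) -> y <=v 0].

End RieszSpaces.

Definition directed_preorder (A : Type) (le : A -> A -> Prop) : Prop :=
  [/\ exists a : A, True,
      forall a, le a a,
      forall a b c, le a b -> le b c -> le a c
    & forall a b, exists2 c, le a c & le b c].

Section BanachLattices.
Context {R : realType}.
Implicit Types E F : banachLatticeType R.

Definition order_continuous_norm E : Prop :=
  forall (A : Type) (le : A -> A -> Prop) (x : A -> E),
    directed_preorder le -> decreasing_to0 le x ->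
    forall e : R, 0 < e -> exists a, forall b, le a b -> `|x b| < e.

Definition norm_bounded_on E F (D : set E) (T : E -> F) : Prop :=
  exists M : R, forall x, D x -> `|T x| <= M * `|x|.

Definition disjoint_bounded_family E F (T : E -> F) (U : set E) : Prop :=
  (forall u, U u ->
     [/\ 0 <=v u, u <> 0 & norm_bounded_on (principal_ideal u) T]) /\
  (forall u v, U u -> U v -> u <> v -> disjoint_elts u v).

Definition maximal_disjoint_bounded_family E F (T : E -> F) (U : set E) :
    Prop :=
  disjoint_bounded_family T U /\
  forall V : set E, disjoint_bounded_family T V -> U `<=` V -> V = U.

(* [ET] is the ideal E_T; it is kept as a parameter since it depends on the
   choice of a maximal family. *)
Definition bounded_singular_decomposition E F (T : E -> F) (ET : set E)
    (B S : E -> F) : Prop :=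
  [/\ forall x, T x = B x + S x,
      norm_bounded_on setT B /\ disjointness_preserving B,
      forall x, ET x -> B x = T x,
      disjointness_preserving S
    & forall x, ET x -> S x = 0].

End BanachLattices.

(* Main.v *)
(* Gliding hump: if z_n are pairwise disjoint with norms <= 2^-n, then
   x = sum z_n satisfies |T z_n| <= |T x|, because x - z_n is disjoint from
   z_n; hence the norms of T z_n stay bounded.
   This first shows that T is bounded on A_v for some 0 < v <= y whenever
   y > 0 (otherwise y dominates no atom and splits forever), so that E_T is
   order dense, and then that T is bounded on E_T.  Order continuity of the norm
   makes E_T norm dense, and R is the continuous extension of T from E_T.  Each
   x is a limit of z_n in E_T with |z_n| <= |x|, so R x = lim T z_n and
   S x = lim T (x - z_n): both operators preserve disjointness. *)

From HB Require Import structures.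
Require Import Defs.
From mathcomp Require Import all_boot all_order all_algebra.
From mathcomp Require Import all_classical all_reals all_analysis.
From mathcomp Require Import ring lra.

Set Implicit Arguments.
Unset Strict Implicit.
Unset Printing Implicit Defensive.

Import Order.TTheory GRing.Theory Num.Theory.
Import numFieldNormedType.Exports.

Local Open Scope classical_set_scope.
Local Open Scope ring_scope.

(** * Order, modulus, disjointness and decomposition in Riesz spaces *)

Section RieszTheory.
Context {R : realFieldType} {E : rieszType R}.
Implicit Types (x y z u v w : E) (a b : R).

Lemma rle_refl x : x <=v x. Proof. exact: riesz_le_refl. Qed.

Lemma rle_trans y x z : x <=v y -> y <=v z -> x <=v z.
Proof. exact: riesz_le_trans. Qed.

Lemma rle_anti x y : x <=v y -> y <=v x -> x = y.
Proof. by move=> xy yx; apply: riesz_le_anti; rewrite xy yx. Qed.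

Lemma rleD2r z x y : (x + z <=v y + z) = (x <=v y).
Proof.
apply/idP/idP => [H|H]; last exact: riesz_leD.
by have := riesz_leD _ _ (- z) H; rewrite !addrK.
Qed.

Lemma rleD x y z w : x <=v y -> z <=v w -> x + z <=v y + w.
Proof.
move=> xy zw; apply: (@rle_trans (y + z)); first by rewrite rleD2r.
by rewrite ![y + _]addrC rleD2r.
Qed.

Lemma rsubr_ge0 x y : (0 <=v y - x) = (x <=v y).
Proof. by rewrite -(rleD2r x) add0r subrK. Qed.

Lemma rleBlDr x y z : (x - z <=v y) = (x <=v y + z).
Proof. by rewrite -(rleD2r z) subrK. Qed.

Lemma rleBrDr x y z : (x <=v y - z) = (x + z <=v y).
Proof. by rewrite -(rleD2r z) subrK. Qed.

Lemma rleN2 x y : (- x <=v - y) = (y <=v x).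
Proof. by rewrite -rsubr_ge0 opprK addrC rsubr_ge0. Qed.

Lemma rleNl x y : (- x <=v y) = (- y <=v x).
Proof. by rewrite -rleN2 opprK. Qed.

Lemma roppr_le0 x : (- x <=v 0) = (0 <=v x).
Proof. by rewrite rleNl oppr0. Qed.

Lemma raddr_ge0 x y : 0 <=v x -> 0 <=v y -> 0 <=v x + y.
Proof. by move=> x0 y0; rewrite -[0]addr0 rleD. Qed.

Lemma rler_wpDr x y z : 0 <=v y -> z <=v x -> z <=v x + y.
Proof. by move=> y0 zx; rewrite -[z]addr0 rleD. Qed.

Lemma rscale_ge0 a x : 0 <= a -> 0 <=v x -> 0 <=v a *: x.
Proof. exact: riesz_scale_ge0. Qed.

Lemma rscale_le a x y : 0 <= a -> x <=v y -> a *: x <=v a *: y.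
Proof.
move=> a0 xy; rewrite -rsubr_ge0 -scalerBr.
by apply: rscale_ge0 => //; rewrite rsubr_ge0.
Qed.

Lemma rscale_lel a b x : a <= b -> 0 <=v x -> a *: x <=v b *: x.
Proof.
move=> ab x0; rewrite -rsubr_ge0 -scalerBl.
by apply: rscale_ge0 => //; rewrite subr_ge0.
Qed.

Lemma rleUl x y : x <=v riesz_join x y.
Proof. by have := rle_refl (riesz_join x y); rewrite riesz_leUx => /andP[]. Qed.

Lemma rleUr x y : y <=v riesz_join x y.
Proof. by have := rle_refl (riesz_join x y); rewrite riesz_leUx => /andP[]. Qed.

Lemma rleIl x y : riesz_meet x y <=v x.
Proof. by have := rle_refl (riesz_meet x y); rewrite riesz_lexI => /andP[]. Qed.

Lemma rleIr x y : riesz_meet x y <=v y.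
Proof. by have := rle_refl (riesz_meet x y); rewrite riesz_lexI => /andP[]. Qed.

Lemma rlub x y z : x <=v z -> y <=v z -> riesz_join x y <=v z.
Proof. by rewrite riesz_leUx => -> ->. Qed.

Lemma rglb x y z : z <=v x -> z <=v y -> z <=v riesz_meet x y.
Proof. by rewrite riesz_lexI => -> ->. Qed.

Lemma rmeet_mono x y z w :
  x <=v y -> z <=v w -> riesz_meet x z <=v riesz_meet y w.
Proof.
move=> xy zw; apply: rglb.
- exact: rle_trans (rleIl _ _) xy.
- exact: rle_trans (rleIr _ _) zw.
Qed.

Lemma modulus_ler x : x <=v modulus x. Proof. exact: rleUl. Qed.

Lemma modulus_lerN x : - x <=v modulus x. Proof. exact: rleUr. Qed.

Lemma modulus_geN x : - modulus x <=v x.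
Proof. by rewrite rleNl; exact: modulus_lerN. Qed.

Lemma modulus_le x y : x <=v y -> - x <=v y -> modulus x <=v y.
Proof. exact: rlub. Qed.

Lemma modulus_ge0 x : 0 <=v modulus x.
Proof.
have : 0 <=v modulus x + modulus x.
  by rewrite -(subrr x) rleD// ?modulus_ler ?modulus_lerN.
rewrite -mulr2n -scaler_nat => x2.
have -> : modulus x = 2^-1 *: (2%:R *: modulus x).
  by rewrite scalerA mulVf ?pnatr_eq0// scale1r.
by apply: rscale_ge0 => //; rewrite invr_ge0 ler0n.
Qed.

Lemma modulus_id x : 0 <=v x -> modulus x = x.
Proof.
move=> x0; apply: rle_anti _ (modulus_ler x).
apply: modulus_le; first exact: rle_refl.
by apply: (rle_trans _ x0); rewrite roppr_le0.
Qed.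

Lemma modulusN x : modulus (- x) = modulus x.
Proof.
have le y : modulus (- y) <=v modulus y.
  by apply: modulus_le; rewrite ?opprK ?modulus_ler ?modulus_lerN.
by apply: rle_anti; [exact: le|have := le (- x); rewrite opprK].
Qed.

Lemma modulus0 : modulus (0 : E) = 0.
Proof. exact/modulus_id/rle_refl. Qed.

Lemma modulusD x y : modulus (x + y) <=v modulus x + modulus y.
Proof.
apply: modulus_le; first by apply: rleD; exact: modulus_ler.
by rewrite opprD; apply: rleD; exact: modulus_lerN.
Qed.

Lemma modulusB x y : modulus (x - y) <=v modulus x + modulus y.
Proof. by rewrite -(modulusN y) modulusD. Qed.

Lemma modulusZ_le a x : modulus (a *: x) <=v `|a| *: modulus x.
Proof.
have H b : 0 <= b -> modulus (b *: x) <=v b *: modulus x.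
  move=> b0; apply: modulus_le; first exact: rscale_le (modulus_ler x).
  by rewrite -scalerN; apply: rscale_le (modulus_lerN x).
have [a0|a0] := leP 0 a; first by rewrite ger0_norm //; exact: H.
by rewrite -modulusN -scaleNr ltr0_norm //; apply: H; rewrite oppr_ge0 ltW.
Qed.

Lemma modulus_eq0 x : modulus x = 0 -> x = 0.
Proof.
move=> x0; apply: rle_anti; first by rewrite -x0 modulus_ler.
by rewrite -[0]oppr0 -x0 modulus_geN.
Qed.

Lemma rmeet_ge0 x y : 0 <=v x -> 0 <=v y -> 0 <=v riesz_meet x y.
Proof. by move=> x0 y0; apply: rglb. Qed.

Lemma rmeetC x y : riesz_meet x y = riesz_meet y x.
Proof. by apply: rle_anti; apply: rglb; rewrite ?rleIl ?rleIr. Qed.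

(** Subtracting [riesz_meet y z] from the left side leaves something below [z], since that meet is
    positive, and below [x], since [riesz_meet (x + y) z - x] is below both [y] and [z]. *)
Lemma rmeetDl_le x y z : 0 <=v x -> 0 <=v y -> 0 <=v z ->
  riesz_meet (x + y) z <=v riesz_meet x z + riesz_meet y z.
Proof.
move=> x0 y0 z0; rewrite -rleBlDr; apply: rglb; last first.
  rewrite rleBlDr; apply: rle_trans (rleIr _ _) _.
  apply: rler_wpDr (rmeet_ge0 _ _) _ => //; exact: rle_refl.
rewrite rleBlDr [x + riesz_meet _ _]addrC -rleBlDr; apply: rglb; rewrite rleBlDr.
  by rewrite [y + x]addrC; exact: rleIl.
by apply: rle_trans (rleIr _ _) _; apply: rler_wpDr => //; exact: rle_refl.
Qed.

Lemma disjoint_eltsP x y :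
  disjoint_elts x y <-> (forall w, w <=v modulus x -> w <=v modulus y -> w <=v 0).
Proof.
split=> [xy w wx wy|xy]; first by rewrite -[0]xy rglb.
apply: rle_anti; first by apply: xy; rewrite ?rleIl ?rleIr.
exact: rmeet_ge0 (modulus_ge0 _) (modulus_ge0 _).
Qed.

Lemma disjoint_eltsC x y : disjoint_elts x y -> disjoint_elts y x.
Proof. by rewrite /disjoint_elts rmeetC. Qed.

Lemma disjoint_elts_mono x y z w : modulus z <=v modulus x ->
  modulus w <=v modulus y -> disjoint_elts x y -> disjoint_elts z w.
Proof.
move=> zx wy /disjoint_eltsP xy; apply/disjoint_eltsP => t tz tw.
by apply: xy; [exact: rle_trans tz zx|exact: rle_trans tw wy].
Qed.

Lemma disjoint_eltsN x y : disjoint_elts x y -> disjoint_elts (- x) y.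
Proof. by rewrite /disjoint_elts modulusN. Qed.

Lemma disjoint_eltsD x y z :
  disjoint_elts x z -> disjoint_elts y z -> disjoint_elts (x + y) z.
Proof.
move=> xz yz; apply/disjoint_eltsP => w wxy wz; rewrite -[0]addr0 -{1}xz -yz.
apply: (rle_trans _) (rmeetDl_le _ _ _); rewrite ?modulus_ge0//.
exact: rglb (rle_trans wxy (modulusD _ _)) wz.
Qed.

Lemma disjoint_elts0 x : disjoint_elts 0 x.
Proof. by apply/disjoint_eltsP => w; rewrite modulus0. Qed.

Lemma disjoint_eltsZ a x y : disjoint_elts x y -> disjoint_elts (a *: x) y.
Proof.
move=> /disjoint_eltsP xy; apply/disjoint_eltsP => w wx wy.
(* Dividing [w] by [c] brings it below [modulus x] because [c] is at least the absolute value of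
   [a], and keeps it below [modulus y] because [1 <= c]; the 1 also covers [a = 0]. *)
pose c := Num.max 1 `|a|.
have c0 : 0 < c by rewrite lt_max ltr01.
have ci0 : 0 <= c^-1 by rewrite invr_ge0 ltW.
have /(rscale_le (ltW c0)) : c^-1 *: w <=v 0.
  apply: xy.
  - apply: rle_trans (rscale_le ci0 (rle_trans wx (modulusZ_le _ _))) _.
    rewrite scalerA -[X in _ <=v X]scale1r; apply: rscale_lel (modulus_ge0 _).
    by rewrite mulrC ler_pdivrMr // mul1r le_max lexx orbT.
  - apply: rle_trans (rscale_le ci0 wy) _.
    rewrite -[X in _ <=v X]scale1r; apply: rscale_lel (modulus_ge0 _).
    by rewrite invf_le1 // le_max lexx.
by rewrite scaler0 scalerA mulfV ?gt_eqF // scale1r.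
Qed.

Lemma disjoint_elts_sum (I : Type) (r : seq I) (P : pred I) (f : I -> E) x :
  (forall i, P i -> disjoint_elts (f i) x) ->
  disjoint_elts (\sum_(i <- r | P i) f i) x.
Proof.
move=> fx; elim/big_rec : _ => [|i y Pi]; first exact: disjoint_elts0.
exact: disjoint_eltsD (fx _ Pi).
Qed.

(** Writing [x] as [(x + y) - y] bounds [modulus x] by the meet of [modulus (x + y) + modulus y]
    with [modulus x]; the share of [y] in this meet vanishes by disjointness. *)
Lemma disjoint_elts_modulus_leD x y :
  disjoint_elts x y -> modulus x <=v modulus (x + y).
Proof.
move=> xy.
have h : modulus x <=v riesz_meet (modulus (x + y) + modulus y) (modulus x).
  apply: rglb (rle_refl _); rewrite -{1}[x](addrK y); exact: modulusB.
have := rle_trans h (rmeetDl_le (modulus_ge0 _) (modulus_ge0 _) (modulus_ge0 _)).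
rewrite [riesz_meet (modulus y) _]rmeetC xy addr0 => /rle_trans; apply.
exact: rleIl.
Qed.

Lemma disjoint_elts_self x : disjoint_elts x x -> x = 0.
Proof.
move=> /disjoint_eltsP xx; apply: modulus_eq0; apply: rle_anti _ (modulus_ge0 _).
by apply: xx; exact: rle_refl.
Qed.

Lemma disjoint_elts_meet0 x y : 0 <=v x -> 0 <=v y ->
  disjoint_elts x y <-> riesz_meet x y = 0.
Proof. by move=> x0 y0; rewrite /disjoint_elts !modulus_id. Qed.

(** The piece [y] is [x] truncated to the order interval from [- u] to [u], and [z] is the
    remainder. The bounds by [modulus x] let solidity of the norm control both pieces by [x]. *)
Lemma riesz_decomposition x u v : 0 <=v u -> 0 <=v v ->
  modulus x <=v u + v ->
  exists y z, [/\ x = y + z, modulus y <=v u, modulus z <=v v,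
    modulus y <=v modulus x & modulus z <=v modulus x].
Proof.
move=> u0 v0 xuv.
have Nu0 : - u <=v 0 by rewrite roppr_le0.
have xle : x <=v u + v := rle_trans (modulus_ler x) xuv.
have Nxle : - x <=v u + v := rle_trans (modulus_lerN x) xuv.
have x0 := modulus_ge0 x.
pose y := riesz_join (riesz_meet x u) (- u).
exists y, (x - y); split; first by rewrite addrC subrK.
- apply: modulus_le; last by rewrite rleNl rleUr.
  by apply: rlub; [exact: rleIr|exact: (rle_trans _ u0)].
- apply: modulus_le.
    rewrite rleBlDr addrC -rleBlDr; apply: (rle_trans _) (rleUl _ _); apply: rglb.
      by rewrite rleBlDr; exact: rler_wpDr v0 (rle_refl _).
    by rewrite rleBlDr.
  rewrite opprB rleBlDr addrC; apply: rlub; last first.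
    by rewrite rleNl opprD rleBlDr.
  exact: rler_wpDr v0 (rleIl _ _).
- apply: modulus_le; first apply: rlub.
  + exact: rle_trans (rleIl _ _) (modulus_ler x).
  + exact: rle_trans Nu0 x0.
  + rewrite rleNl; apply: (rle_trans _) (rleUl _ _); apply: rglb.
      exact: modulus_geN.
    by apply: (rle_trans _ u0); rewrite roppr_le0.
- apply: modulus_le.
    rewrite rleBlDr addrC -rleBlDr; apply: (rle_trans _) (rleUl _ _); apply: rglb.
      by rewrite rleBlDr; exact: rler_wpDr x0 (rle_refl _).
    by apply: (rle_trans _ u0); rewrite rleBlDr add0r modulus_ler.
  rewrite opprB rleBlDr addrC; apply: rlub; first exact: rler_wpDr x0 (rleIl _ _).
  apply: (rle_trans Nu0) _; rewrite -(subrr x) -[_ - x]addrC addrC.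
  by rewrite rleD // ?rle_refl // modulus_lerN.
Qed.

Definition pospart x : E := riesz_join x 0.

Lemma pospart_ge0 x : 0 <=v pospart x. Proof. exact: rleUr. Qed.

Lemma pospart_ler x : x <=v pospart x. Proof. exact: rleUl. Qed.

Lemma pospart_le_modulus x : pospart x <=v modulus x.
Proof. exact: rlub (modulus_ler x) (modulus_ge0 x). Qed.

Lemma pospartBN x : pospart x - pospart (- x) = x.
Proof.
apply: rle_anti; last first.
  rewrite rleBrDr addrC -rleBrDr; apply: rlub.
    by rewrite rleBrDr addNr pospart_ge0.
  by rewrite rsubr_ge0 pospart_ler.
rewrite rleBlDr; apply: rlub.
  by rewrite -{1}[x]addr0 rleD ?rle_refl ?pospart_ge0.
by rewrite -(subrr x) rleD ?rle_refl ?pospart_ler.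
Qed.

(** If [m] is the meet, [pospart x - m] still dominates [x] and 0, hence dominates [pospart x],
    which forces [m <=v 0]. *)
Lemma pospart_disjoint x : disjoint_elts (pospart x) (pospart (- x)).
Proof.
apply/(disjoint_elts_meet0 (pospart_ge0 _) (pospart_ge0 _)).
apply: rle_anti; last exact: rmeet_ge0 (pospart_ge0 _) (pospart_ge0 _).
set m := riesz_meet _ _.
have : pospart x <=v pospart x - m.
  apply: rlub; last by rewrite rsubr_ge0 rleIl.
  rewrite rleBrDr addrC -rleBrDr.
  by have -> : pospart x - x = pospart (- x);
    [rewrite -{2}(pospartBN x) subKr|exact: rleIr].
by rewrite -[X in X <=v _]addr0 ![pospart x + _]addrC rleD2r -roppr_le0 opprK.
Qed.

End RieszTheory.

(** * Extension by continuity from a dense subspace *)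

Section BoundedExtension.
Context {K : realType} {E : normedModType K} {F : completeNormedModType K}.

Lemma norm_le_eq0 (V : normedModType K) (x : V) :
  (forall e : K, 0 < e -> `|x| <= e) -> x = 0.
Proof.
move=> x0; apply/eqP; rewrite -normr_eq0 eq_le normr_ge0 andbT.
by apply/ler_addgt0Pr => e e0; rewrite add0r x0.
Qed.

(** [T] is bounded only on [D], so [R] may differ from it elsewhere. The single estimate yields
    agreement on [D] at [x = z] and boundedness at [z = 0], and it determines [R x] because [D] is
    dense. *)
Lemma bounded_extension (T : {linear E -> F}) (D : set E) (M : K) :
  0 < M ->
  (forall (a : K) x y, D x -> D y -> D (a *: x + y)) ->
  (forall x (e : K), 0 < e -> exists2 z, D z & `|x - z| < e) ->
  (forall x, D x -> `|T x| <= M * `|x|) ->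
  exists R : {linear E -> F}, forall x z, D z -> `|R x - T z| <= M * `|x - z|.
Proof.
move=> M0 Dlin Ddense TM.
have DB x y : D x -> D y -> D (x - y).
  by move=> Dx Dy; rewrite addrC -scaleN1r; exact: Dlin.
have TB x y : D x -> D y -> `|T x - T y| <= M * `|x - y|.
  by move=> Dx Dy; rewrite -linearB; exact/TM/DB.
(* [R x] is the limit of [T] along a sequence of [D] tending to [x]; comparing with a late term
   through [TB] gives the estimate. *)
have /choice[R RT] : forall x, exists y, forall z, D z -> `|y - T z| <= M * `|x - z|.
  move=> x.
  have /choice[z zP] : forall n : nat, exists z, D z /\ `|x - z| < n.+1%:R^-1.
    move=> n; have [|z Dz xz] := Ddense x n.+1%:R^-1; first by rewrite invr_gt0.
    by exists z.
  have zlim (e : K) : 0 < e -> \forall n \near \oo, M * `|x - z n| < e.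
    move=> e0; have eM : 0 < e / M by rewrite divr_gt0.
    near=> n; rewrite mulrC -ltr_pdivlMr //; apply: lt_trans (zP n).2 _.
    by near: n; exact: near_infty_natSinv_lt (PosNum eM).
  have : cvgn (T \o z).
    apply/cauchy_cvgP; apply: cauchy_exP => e e0.
    have e2 : 0 < e / 2 by rewrite divr_gt0.
    have [N _ zN] := zlim _ e2.
    exists (T (z N)); exists N => // n Nn /=.
    rewrite -ball_normE /=; apply: le_lt_trans (TB _ _ (zP N).1 (zP n).1) _.
    have -> : z N - z n = (x - z n) - (x - z N) by rewrite opprB [RHS]addrC addrA subrK.
    apply: le_lt_trans (_ : M * (`|x - z n| + `|x - z N|) < e).
      by rewrite ler_pM2l // ler_normB.
    by rewrite mulrDr [ltRHS]splitr ltrD //; apply: zN => /=.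
  move=> /cvg_ex[y /= zy]; exists y => w Dw; apply/ler_addgt0Pr => e e0.
  have e2 : 0 < e / 2 by rewrite divr_gt0.
  have [N _ zN] := zlim _ e2.
  have /cvgrPdist_lt/(_ _ e2)[N' _ yN'] := zy.
  pose n := maxn N N'.
  have yn : `|y - T (z n)| < e / 2 by apply: yN'; rewrite /= leq_maxr.
  have xn : M * `|x - z n| < e / 2 by apply: zN; rewrite /= leq_maxl.
  have -> : y - T w = (y - T (z n)) + (T (z n) - T w) by rewrite addrA subrK.
  apply: le_trans (ler_normD _ _) _.
  have h1 := TB _ _ (zP n).1 Dw.
  have h2 : M * `|z n - w| <= M * `|x - z n| + M * `|x - w|.
    rewrite -mulrDr ler_pM2l //.
    have -> : z n - w = (x - w) - (x - z n) by rewrite opprB [RHS]addrC addrA subrK.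
    by rewrite [leRHS]addrC ler_normB.
  lra.
have Rlin : linear R.
  move=> a x y; apply/eqP; rewrite -subr_eq0; apply/eqP/norm_le_eq0 => e e0.
  (* The estimate at the combination and the combined estimates at [x] and [y] each cost at most
     [M * (|a| + 1) * d], so together they cost [e]. *)
  pose d := e / (2 * M * (`|a| + 1)).
  have a1 : 0 < `|a| + 1 by rewrite ltr_wpDl.
  have d0 : 0 < d by rewrite divr_gt0 // !mulr_gt0.
  have [u Du xu] := Ddense x _ d0; have [v Dv yv] := Ddense y _ d0.
  have h1 := RT (a *: x + y) _ (Dlin a _ _ Du Dv).
  have h2 := RT x _ Du; have h3 := RT y _ Dv.
  have h4 : `|a *: x + y - (a *: u + v)| <= `|a| * `|x - u| + `|y - v|.
    by rewrite opprD addrACA -scalerBr -normrZ ler_normD.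
  have -> : R (a *: x + y) - (a *: R x + R y) =
    (R (a *: x + y) - T (a *: u + v)) - (a *: (R x - T u) + (R y - T v)).
    rewrite linearP scalerBr addrACA -opprD [in RHS]opprB addrA.
    by rewrite subrK.
  apply: le_trans (ler_normB _ _) _.
  have h5 : `|a *: (R x - T u) + (R y - T v)| <= `|a| * `|R x - T u| + `|R y - T v|.
    by rewrite -normrZ ler_normD.
  have h6 : `|a| * `|R x - T u| <= `|a| * (M * `|x - u|) by rewrite ler_wpM2l.
  have h7 : `|a| * `|x - u| <= `|a| * d by rewrite ler_wpM2l // ltW.
  have h8 : M * (`|a| * `|x - u| + `|y - v|) <= M * (`|a| * d + d).
    by rewrite ler_pM2l // lerD // ltW.
  have h9 : M * `|a *: x + y - (a *: u + v)| <= M * (`|a| * `|x - u| + `|y - v|).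
    by rewrite ler_pM2l.
  have h10 : 2 * (M * (`|a| * d + d)) = e.
    by rewrite /d; field; rewrite !gt_eqF.
  lra.
pose Rm := GRing.isLinear.Build K E F *:%R R Rlin.
pose R' : {linear E -> F} := HB.pack R Rm.
by exists R'.
Unshelve. all: by end_near. Qed.

End BoundedExtension.

(** * Norm and disjointness in Banach lattices; the gliding hump *)

Section BanachLatticeTheory.
Context {K : realType}.
Implicit Types E F : banachLatticeType K.

Lemma norm_modulus E (x : E) : `|modulus x| = `|x|.
Proof.
apply/eqP; rewrite eq_le; apply/andP.
by split; apply: norm_solid; rewrite (modulus_id (modulus_ge0 x)) rle_refl.
Qed.

Lemma norm_mono E (x y : E) : 0 <=v x -> x <=v y -> `|x| <= `|y|.
Proof.
by move=> x0 xy; apply: norm_solid; rewrite !modulus_id //; exact: rle_trans xy.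
Qed.

(** When [x'] and [y'] are disjoint, applying [rmeetDl_le] in each variable bounds the meet of
    [modulus x] and [modulus y] by [modulus (x - x') + modulus (y - y')], which is small in norm. *)
Lemma disjoint_elts_closed E (x y : E) :
  (forall e : K, 0 < e -> exists x' y',
    [/\ disjoint_elts x' y', `|x - x'| <= e & `|y - y'| <= e]) ->
  disjoint_elts x y.
Proof.
move=> xy; apply: norm_le_eq0 => e e0.
have [|x' [y' [d xx' yy']]] := xy (e / 2); first by rewrite divr_gt0.
have le (a b : E) : modulus a <=v modulus (a - b) + modulus b.
  by have := modulusD (a - b) b; rewrite subrK.
have m0 := @modulus_ge0 K E.
have h : riesz_meet (modulus x) (modulus y) <=v modulus (x - x') + modulus (y - y').
  apply: rle_trans (rmeet_mono (le x x') (rle_refl _)) _.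
  apply: rle_trans (rmeetDl_le (m0 _) (m0 _) (m0 _)) _.
  apply: rleD (rleIl _ _) _; rewrite rmeetC.
  apply: rle_trans (rmeet_mono (le y y') (rle_refl _)) _.
  apply: rle_trans (rmeetDl_le (m0 _) (m0 _) (m0 _)) _.
  by rewrite [riesz_meet (modulus y') _]rmeetC d addr0 rleIl.
apply: le_trans (norm_mono (rmeet_ge0 (m0 _) (m0 _)) h) _.
apply: le_trans (ler_normD _ _) _; rewrite !norm_modulus; lra.
Qed.

(** The sets in [P] record the room left for later humps: a step takes [z] from [D] and shrinks [D]
    to a [D'] disjoint from [z]. This form serves both for principal ideals below a fixed element
    and for the elements disjoint from finitely many members of a disjoint family. *)
Lemma gliding_hump E F (T : {linear E -> F}) (P : set (set E)) :
  disjointness_preserving T ->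
  (forall D (e M : K), P D -> 0 < e -> exists D' z,
    [/\ P D' /\ D' `<=` D, D z, forall x, D' x -> disjoint_elts z x,
        `|z| <= e & M < `|T z|]) ->
  P = set0.
Proof.
move=> dT step; rewrite -subset0 => D0 PD0.
(* The choice ranges over all pairs of a set in [P] and a stage [p.2], so that the sequence [D] can
   be defined by plain recursion. *)
have /choice[f fP] : forall p : {D | P D} * nat, exists q : {D | P D} * E,
    [/\ sval q.1 `<=` sval p.1, sval p.1 q.2,
        forall x, sval q.1 x -> disjoint_elts q.2 x,
        `|q.2| <= 2^-1 ^+ p.2 & p.2%:R < `|T q.2|].
  move=> [[D PD] n] /=.
  have [|D' [z [[PD' D'D] Dz zD' ze zT]]] := step D (2^-1 ^+ n) n%:R PD.
    by rewrite exprn_gt0.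
  by exists (exist _ D' PD', z).
pose D := fix D n := if n is m.+1 then (f (D m, m)).1 else exist _ D0 PD0.
pose z n := (f (D n, n)).2.
have Dmono m n : (m <= n)%N -> sval (D n) `<=` sval (D m).
  move=> /subnKC <-; elim: (n - m)%N => [|k IH]; first by rewrite addn0.
  by rewrite addnS; apply: subset_trans IH; case: (fP (D (m + k)%N, (m + k)%N)).
have zlt m n : (m < n)%N -> disjoint_elts (z m) (z n).
  move=> mn; have [_ _ + _ _] := fP (D m, m); apply; apply: (Dmono _ _ mn).
  by have [_ + _ _ _] := fP (D n, n).
have zdisj m n : m != n -> disjoint_elts (z m) (z n).
  by rewrite neq_ltn => /orP[|] mn; [|apply: disjoint_eltsC]; exact: zlt.
have : cvgn (series z).
  apply: normed_cvg; apply: (@series_le_cvg _ _ (geometric 1 2^-1)) => [n|n|n|].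
  - exact: normr_ge0.
  - by rewrite /= mul1r exprn_ge0.
  - by rewrite /= mul1r; have [_ _ _ + _] := fP (D n, n).
  - by apply: is_cvg_geometric_series; rewrite ger0_norm // invf_lt1 // ltr1n.
move=> /cvg_ex[x /= zx].
(* [x - z n] is the limit of the partial sums with the term of index [n] deleted; [n.+1] in [maxn]
   ensures that this term occurs in [series z m], which stops before index [m]. *)
have xz n : disjoint_elts (z n) (x - z n).
  apply/disjoint_eltsC/disjoint_elts_closed => e e0.
  have /cvgrPdist_le/(_ _ e0)[N _ zN] := zx.
  pose m := maxn N n.+1.
  exists (series z m - z n), (z n); split; last by rewrite subrr normr0 ltW.
    rewrite /series /= big_mkord (bigD1 (Ordinal (leq_maxr N n.+1))) //=.
    rewrite [z n + _]addrC addrK; apply: disjoint_elts_sum => i /eqP ni; apply: zdisj.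
    by apply/eqP => ni'; apply: ni; apply: val_inj.
  by rewrite opprB addrA subrK; apply: zN; rewrite /= leq_maxl.
have [n] : exists n : nat, `|T x| < n%:R.
  by exists (Num.truncn `|T x|).+1; exact: truncnS_gt.
apply/negP; rewrite -leNgt.
have [_ _ _ _ /ltW/le_trans] := fP (D n, n); apply; rewrite -/(z n).
apply: norm_solid.
by rewrite -(subrKC (z n) x) linearD; apply/disjoint_elts_modulus_leD/dT/xz.
Qed.

(** A vector violating the bound with constant [|M| / e] has nonzero image, and rescaling it to norm
    [e] gives [z]. The absolute value covers negative [M]. *)
Lemma unbounded_pick E F (T : {linear E -> F}) (D : set E) :
  (forall (a : K) x, D x -> D (a *: x)) -> ~ norm_bounded_on D T ->
  forall e M : K, 0 < e -> exists z, [/\ D z, `|z| <= e & M < `|T z|].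
Proof.
move=> DZ unb e M e0.
have [x Dx xM] : exists2 x, D x & `|M| / e * `|x| < `|T x|.
  apply: contrapT => no; apply: unb; exists (`|M| / e) => x Dx.
  by rewrite leNgt; apply/negP => xM; apply: no; exists x.
have x0 : 0 < `|x|.
  rewrite normr_gt0; apply: contraPneq xM => ->.
  by rewrite linear0 !normr0 mulr0 ltxx.
have c0 : 0 <= e / `|x| by rewrite divr_ge0 // ltW.
exists ((e / `|x|) *: x); split; first exact: DZ.
  by rewrite normrZ ger0_norm // divfK // gt_eqF.
rewrite linearZ_LR normrZ [`|e / _|]ger0_norm //.
apply: le_lt_trans (ler_norm M) _.
move: xM; rewrite -(ltr_pM2l (divr_gt0 e0 x0)); apply: le_lt_trans.
by rewrite le_eqVlt; apply/orP; left; apply/eqP; field; rewrite !gt_eqF.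
Qed.

(** * Principal ideals and boundedness of an operator on them *)

Lemma principal_mono E (u v : E) : 0 <=v u -> u <=v v ->
  principal_ideal u `<=` principal_ideal v.
Proof.
by move=> u0 uv x [a a0 xa]; exists a => //; exact: rle_trans xa (rscale_le a0 uv).
Qed.

Lemma principalZ E (u : E) (a : K) (x : E) :
  principal_ideal u x -> principal_ideal u (a *: x).
Proof.
move=> [b b0 xb]; exists (`|a| * b); first by rewrite mulr_ge0.
rewrite -scalerA; apply: rle_trans (modulusZ_le _ _) _; exact: rscale_le xb.
Qed.

Lemma principal_disjoint E (u v x y : E) : 0 <=v u -> 0 <=v v ->
  disjoint_elts u v -> principal_ideal u x -> principal_ideal v y ->
  disjoint_elts x y.
Proof.
move=> u0 v0 uv [a a0 xa] [b b0 yb].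
apply: (@disjoint_elts_mono _ _ (a *: u) (b *: v)).
- by rewrite (@modulus_id _ _ (a *: u)) //; exact: rscale_ge0.
- by rewrite (@modulus_id _ _ (b *: v)) //; exact: rscale_ge0.
- by apply/disjoint_eltsZ/disjoint_eltsC/disjoint_eltsZ/disjoint_eltsC.
Qed.

(** The constants in [norm_bounded_on] may be negative, hence the absolute values before the norm of
    a piece is enlarged to that of [y + z]. *)
Lemma norm_splitting_le E F (T : {linear E -> F}) (y z : E) (M N : K) :
  modulus y <=v modulus (y + z) -> modulus z <=v modulus (y + z) ->
  `|T y| <= M * `|y| -> `|T z| <= N * `|z| ->
  `|T (y + z)| <= (`|M| + `|N|) * `|y + z|.
Proof.
move=> yx zx hy hz.
have le_abs (L b c : K) : 0 <= b -> b <= c -> L * b <= `|L| * c.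
  move=> b0 bc; apply: le_trans (_ : `|L| * b <= _).
    by rewrite ler_wpM2r // ler_norm.
  by rewrite ler_wpM2l.
rewrite linearD mulrDl; apply: le_trans (ler_normD _ _) _.
apply: lerD; [apply: le_trans hy _|apply: le_trans hz _];
  by apply: le_abs => //; exact: norm_solid.
Qed.

Lemma norm_bounded_principalD E F (T : {linear E -> F}) (u v : E) :
  0 <=v u -> 0 <=v v ->
  norm_bounded_on (principal_ideal u) T -> norm_bounded_on (principal_ideal v) T ->
  norm_bounded_on (principal_ideal (u + v)) T.
Proof.
move=> u0 v0 [M TM] [N TN]; exists (`|M| + `|N|) => x [a a0]; rewrite scalerDr => xa.
have [y [z [-> yu zv yx zx]]] :=
  riesz_decomposition (rscale_ge0 a0 u0) (rscale_ge0 a0 v0) xa.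
have hy : `|T y| <= M * `|y| by apply: TM; exists a.
have hz : `|T z| <= N * `|z| by apply: TN; exists a.
exact: norm_splitting_le yx zx hy hz.
Qed.

(** The principal ideal of such a [v] is the line spanned by [v]: each of its elements is comparable
    with every multiple of [v]. *)
Lemma norm_bounded_atom E F (T : {linear E -> F}) (v : E) :
  0 <=v v -> v <> 0 ->
  (forall a b, 0 <=v a -> a <=v v -> 0 <=v b -> b <=v v -> disjoint_elts a b ->
    a = 0 \/ b = 0) ->
  norm_bounded_on (principal_ideal v) T.
Proof.
move=> v0 vn0 atom.
have nv : 0 < `|v| by rewrite normr_gt0; apply/eqP.
suff line x : principal_ideal v x -> exists t, x = t *: v.
  exists (`|T v| / `|v|) => x /line[t ->].
  rewrite linearZ_LR !normrZ le_eqVlt; apply/orP; left; apply/eqP; field.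
  by rewrite gt_eqF.
move=> [a a0 xa].
have cmp t : x <=v t *: v \/ t *: v <=v x.
  (* [c] is positive and [modulus y <=v c *: v], so the positive and negative parts of [y] divided
     by [c] lie below [v]; being disjoint, one of them vanishes by [atom]. *)
  pose y := x - t *: v; pose c := a + `|t| + 1.
  have c0 : 0 < c by rewrite ltr_wpDl // addr_ge0.
  have ci0 : 0 <= c^-1 by rewrite invr_ge0 ltW.
  have yc : modulus y <=v c *: v.
    apply: rle_trans (modulusB _ _) _.
    apply: (@rle_trans _ _ ((a + `|t|) *: v)).
      rewrite scalerDl; apply: rleD => //.
      by apply: rle_trans (modulusZ_le _ _) _; rewrite modulus_id // rle_refl.
    by apply: rscale_lel => //; rewrite lerDl.
  have le p : p <=v modulus y -> c^-1 *: p <=v v.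
    move=> /rle_trans/(_ yc)/(rscale_le ci0).
    by rewrite scalerA mulVf ?scale1r // gt_eqF.
  have cn0 : c^-1 != 0 by rewrite invr_eq0 gt_eqF.
  have [||||||] := atom (c^-1 *: pospart y) (c^-1 *: pospart (- y)).
  - exact: rscale_ge0 (pospart_ge0 _).
  - exact/le/pospart_le_modulus.
  - exact: rscale_ge0 (pospart_ge0 _).
  - by apply: le; rewrite -(modulusN y) pospart_le_modulus.
  - by apply/disjoint_eltsZ/disjoint_eltsC/disjoint_eltsZ/disjoint_eltsC/pospart_disjoint.
  - move=> /eqP; rewrite scaler_eq0 (negPf cn0) /= => /eqP y0; left.
    by have := pospart_ler y; rewrite y0 rleBlDr add0r.
  - move=> /eqP; rewrite scaler_eq0 (negPf cn0) /= => /eqP y0; right.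
    by have := pospart_ler (- y); rewrite y0 opprB rleBlDr add0r.
(* A cut in the reals: [x] must be [sup S *: v], since the modulus of the difference is below every
   positive multiple of [v]. *)
pose S := [set t : K | t *: v <=v x].
have Sa : ubound S a.
  move=> t /= tx; rewrite leNgt; apply/negP => at_.
  apply: vn0; have : (t - a) *: v <=v 0.
    rewrite scalerBl rleBlDr add0r; apply: rle_trans tx _.
    exact: rle_trans (modulus_ler x) xa.
  move=> /rle_anti/(_ (rscale_ge0 _ v0)); rewrite subr_ge0 => /(_ (ltW at_)).
  by move/eqP; rewrite scaler_eq0 subr_eq0 gt_eqF // => /eqP.
have supS : has_sup S.
  split; last by exists a.
  exists (- a); rewrite /S /= scaleNr rleNl.
  exact: rle_trans (modulus_lerN x) xa.
exists (sup S); apply/eqP; rewrite -subr_eq0; apply/eqP/norm_le_eq0 => e e0.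
have d0 : 0 < e / `|v| by rewrite divr_gt0.
set d := e / `|v| in d0.
have h : modulus (x - sup S *: v) <=v d *: v.
  apply: modulus_le.
    rewrite rleBlDr -scalerDl; have [//|] := cmp (d + sup S).
    move=> /(sup_upper_bound supS); rewrite leNgt => /negP[].
    by rewrite ltrDr.
  have [t St dt] := sup_adherent d0 supS.
  rewrite opprB rleBlDr addrC -rleBlDr -scalerBl.
  by apply: rle_trans St; exact: rscale_lel (ltW dt) v0.
apply: le_trans (_ : `|d *: v| <= e); last first.
  by rewrite normrZ (ger0_norm (ltW d0)) divfK // gt_eqF.
by rewrite -norm_modulus norm_mono // modulus_ge0.
Qed.

(** Otherwise [T] is unbounded on the principal ideal of every nonzero positive [v] below [y], so no
    such [v] is an atom and each dominates two disjoint nonzero elements [a] and [b]. The hump comes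
    from the ideal of [a]; the ideal of [b] is kept for later humps. *)
Lemma norm_bounded_below E F (T : {linear E -> F}) (y : E) :
  disjointness_preserving T -> 0 <=v y -> y <> 0 ->
  exists v, [/\ 0 <=v v, v <=v y, v <> 0 & norm_bounded_on (principal_ideal v) T].
Proof.
move=> dT y0 yn0; apply: contrapT => no.
have unb v : 0 <=v v -> v <=v y -> v <> 0 -> ~ norm_bounded_on (principal_ideal v) T.
  by move=> v0 vy vn0 b; apply: no; exists v.
pose P := [set principal_ideal v | v in [set v | [/\ 0 <=v v, v <=v y & v <> 0]]].
suff P0 : P = set0.
  have : P (principal_ideal y) by exists y => //; split=> //; exact: rle_refl.
  by rewrite P0.
apply: (gliding_hump dT) => _ e M [v [v0 vy vn0] <-] e0.
have [a [b [[a0 av an0] [b0 bv bn0] ab]]] : exists a b,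
    [/\ [/\ 0 <=v a, a <=v v & a <> 0], [/\ 0 <=v b, b <=v v & b <> 0]
      & disjoint_elts a b].
  apply: contrapT => nosplit; apply: (unb _ v0 vy vn0).
  apply: norm_bounded_atom => // a b a0 av b0 bv ab.
  apply: contrapT => /not_orP[an0 bn0]; apply: nosplit.
  by exists a, b.
have [z [az ze zM]] := unbounded_pick (@principalZ _ a)
  (unb _ a0 (rle_trans av vy) an0) M e0.
exists (principal_ideal b), z; split=> //.
- split; last exact: principal_mono.
  by exists b => //; split=> //; exact: rle_trans bv vy.
- exact: principal_mono az.
- by move=> x; exact: principal_disjoint az.
Qed.

End BanachLatticeTheory.

(** * Generated ideals: boundedness, order density and norm density *)

Section IdealsOfBanachLattices.
Context {K : realType}.
Implicit Types E F : banachLatticeType K.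

Lemma generated_ideal_is_ideal E (U : set E) : is_ideal (generated_ideal U).
Proof.
split=> [I [[I0 _ _] _] //|a x y Ix Iy J JU|x y yx Ix J JU].
  by have [[_ JD _] _] := JU; apply: JD; [exact: Ix|exact: Iy].
by have [[_ _ JS] _] := JU; apply: JS yx _; exact: Ix.
Qed.

Lemma sub_generated_ideal E (U : set E) : U `<=` generated_ideal U.
Proof. exact: sub_gen_smallest. Qed.

Lemma riesz_sum_ge0 E (s : seq E) (P : pred E) :
  (forall u, u \in s -> 0 <=v u) -> 0 <=v \sum_(u <- s | P u) u.
Proof.
move=> s0; rewrite big_seq_cond; elim/big_rec : _ => [|u x /andP[us _] x0].
  exact: rle_refl.
exact: raddr_ge0 (s0 _ us) x0.
Qed.

(** Each entry of [t] lying in [s] costs at most one copy of the sum over [s]; entries of [t] may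
    repeat, hence the factor [size t]. *)
Lemma sum_le_size E (s t : seq E) :
  (forall u, u \in s -> 0 <=v u) ->
  \sum_(u <- t | u \in s) u <=v (size t)%:R *: \sum_(u <- s) u.
Proof.
move=> s0; elim: t => [|u t IH]; first by rewrite big_nil scale0r rle_refl.
have S0 := riesz_sum_ge0 predT s0.
rewrite big_cons /= -natr1 scalerDl scale1r; case: ifP => us; last exact: rler_wpDr.
rewrite addrC; apply: rleD => //; rewrite (big_rem u) //=.
apply: rler_wpDr (rle_refl _); apply: riesz_sum_ge0 => v /mem_rem; exact: s0.
Qed.

(** For positive [U] this is an explicit form of the generated ideal; repetitions in [s] stand for
    coefficients. *)
Definition finitely_dominated E (U : set E) : set E :=
  [set x | exists s : seq E, (forall u, u \in s -> U u) /\
    modulus x <=v \sum_(u <- s) u].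

Lemma finitely_dominated_is_ideal E (U : set E) :
  (forall u, U u -> 0 <=v u) -> is_ideal (finitely_dominated U).
Proof.
move=> U0.
have solid x y : modulus y <=v modulus x -> finitely_dominated U x ->
    finitely_dominated U y.
  by move=> yx [s [sU xs]]; exists s; split=> //; exact: rle_trans xs.
have D x y : finitely_dominated U x -> finitely_dominated U y ->
    finitely_dominated U (x + y).
  move=> [s [sU xs]] [t [tU yt]]; exists (s ++ t); split.
    by move=> u; rewrite mem_cat => /orP[/sU|/tU].
  by rewrite big_cat /=; apply: rle_trans (modulusD _ _) (rleD xs yt).
have zero : finitely_dominated U 0.
  by exists [::]; rewrite big_nil modulus0; split=> //; exact: rle_refl.
split=> // a x y Jx Jy; apply: (D _ _ _ Jy).
(* Additivity gives natural multiples only; a general [a] is then handled by solidity, through a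
   natural number above its absolute value. *)
have Jnx n : finitely_dominated U (n%:R *: modulus x).
  elim: n => [|n IH]; first by rewrite scale0r.
  rewrite -natr1 scalerDl scale1r; apply: (D _ _ IH); apply: solid Jx.
  by rewrite (modulus_id (modulus_ge0 x)) rle_refl.
apply: (solid _ _ _ (Jnx (Num.truncn `|a|).+1)).
apply: rle_trans (modulusZ_le a x) _; rewrite (@modulus_id _ _ (_ *: _)).
  by apply: rscale_lel (modulus_ge0 x); rewrite ltW // truncnS_gt.
by apply: rscale_ge0 (modulus_ge0 x).
Qed.

Lemma norm_bounded_principal_sum E F (T : {linear E -> F}) (s : seq E) :
  (forall u, u \in s -> 0 <=v u /\ norm_bounded_on (principal_ideal u) T) ->
  norm_bounded_on (principal_ideal (\sum_(u <- s) u)) T.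
Proof.
elim: s => [_|u s IH sT].
  exists 0 => x [a _]; rewrite big_nil scaler0 => x0.
  rewrite (@modulus_eq0 _ _ x) ?linear0 ?normr0 ?mul0r //.
  exact: rle_anti x0 (modulus_ge0 x).
have [u0 Tu] := sT u (mem_head _ _).
have sT' v : v \in s -> 0 <=v v /\ norm_bounded_on (principal_ideal v) T.
  by move=> vs; apply: sT; rewrite inE vs orbT.
rewrite big_cons; apply: norm_bounded_principalD => //; last exact: IH.
by apply: riesz_sum_ge0 => v /sT'[].
Qed.

Lemma norm_bounded_generated_ideal E F (T : {linear E -> F}) (U : set E) :
  disjointness_preserving T -> disjoint_bounded_family T U ->
  norm_bounded_on (generated_ideal U) T.
Proof.
move=> dT [UP Udisj].
have U0 u : U u -> 0 <=v u by case/UP.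
have [J0 JD JS] := finitely_dominated_is_ideal U0.
suff [M TM] : norm_bounded_on (finitely_dominated U) T.
  exists M => x Ux; apply: TM; apply: Ux; split=> // u Uu.
  exists [:: u]; rewrite big_seq1 modulus_id ?U0 //.
  by split; [move=> v; rewrite inE => /eqP ->|exact: rle_refl].
have [//|unb] := pselect (norm_bounded_on (finitely_dominated U) T).
(* The room left after finitely many humps: the elements of the ideal disjoint from the members of
   [U] listed in [s]. *)
pose D (s : seq E) := finitely_dominated U `&` [set x | disjoint_elts x (\sum_(u <- s) u)].
pose P := [set D s | s in [set s : seq E | forall u, u \in s -> U u]].
suff P0 : P = set0 by have : P (D [::]); [exists [::]|rewrite P0].
apply: (gliding_hump dT) => _ e M [s sU <-] e0.
have s0 u : u \in s -> 0 <=v u by move=> /sU/U0.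
have DZ (a : K) x : D s x -> D s (a *: x).
  move=> [Jx dx]; split; last exact: disjoint_eltsZ.
  by rewrite -[a *: x]addr0; exact: JD.
(* The ideal splits into a part in the principal ideal of the sum over [s], where [T] is bounded,
   and a part in [D s]; a bound on [D s] would therefore bound [T] on the whole ideal. *)
have unbD : ~ norm_bounded_on (D s) T.
  move=> [M1 TM1].
  have [M2 TM2] : norm_bounded_on (principal_ideal (\sum_(u <- s) u)) T.
    by apply: norm_bounded_principal_sum => u /sU Uu; have [] := UP _ Uu.
  apply: unb; exists (`|M2| + `|M1|) => x [t [tU]].
  (* The entries of [t] outside [s] are disjoint from those of [s], so the piece of [x] that they
     dominate falls in [D s]. *)
  rewrite (bigID (mem s)) /= => xt.
  have t0 u : u \in t -> 0 <=v u by move=> /tU/U0.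
  have [y [z [-> ys zs yx zx]]] := riesz_decomposition
    (riesz_sum_ge0 _ t0) (riesz_sum_ge0 _ t0) xt.
  have hy : `|T y| <= M2 * `|y|.
    by apply: TM2; exists (size t)%:R => //; exact: rle_trans ys (sum_le_size _ s0).
  have hz : `|T z| <= M1 * `|z|.
    apply: TM1; split.
      exists [seq u <- t | u \notin s]; rewrite big_filter; split=> // u.
      by rewrite mem_filter => /andP[_ /tU].
    apply: (@disjoint_elts_mono _ _ (\sum_(u <- t | u \notin s) u) (\sum_(u <- s) u)).
    - by rewrite (modulus_id (riesz_sum_ge0 _ t0)).
    - exact: rle_refl.
    rewrite big_seq_cond; apply: disjoint_elts_sum => u /andP[ut us].
    rewrite big_seq; apply/disjoint_eltsC/disjoint_elts_sum => v vs.
    apply: Udisj; [exact: sU|exact: tU|].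
    by move=> vu; rewrite -vu vs in us.
  exact: norm_splitting_le yx zx hy hz.
have [z [[Jz dz] ze zM]] := unbounded_pick DZ unbD M e0.
have [t [tU zt]] := Jz.
have t0 u : u \in t -> 0 <=v u by move=> /tU/U0.
have S0 := riesz_sum_ge0 predT s0; have T0 := riesz_sum_ge0 predT t0.
have ST0 : 0 <=v \sum_(u <- s ++ t) u by rewrite big_cat; exact: raddr_ge0.
(* [z] is dominated by the sum over [t], so everything disjoint from the sum over [s ++ t] is
   disjoint from [z]. *)
exists (D (s ++ t)), z; split=> //.
- split.
    by exists (s ++ t) => // u; rewrite mem_cat => /orP[/sU|/tU].
  move=> x [Jx dx]; split=> //; apply: disjoint_elts_mono dx; first exact: rle_refl.
  rewrite !modulus_id // big_cat; exact: rler_wpDr (rle_refl _).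
- move=> x [_ dx]; apply/disjoint_eltsC; apply: disjoint_elts_mono dx.
    exact: rle_refl.
  rewrite (modulus_id ST0) big_cat /=; apply: rle_trans zt _.
  by rewrite addrC; exact: rler_wpDr (rle_refl _).
Qed.

(** Below a nonzero [modulus y] lies some [v] on whose principal ideal [T] is bounded; it can be
    added to [U], so it is already in [U] by maximality and is disjoint from itself. *)
Lemma maximal_family_order_dense E F (T : {linear E -> F}) (U : set E) :
  disjointness_preserving T -> maximal_disjoint_bounded_family T U ->
  forall y, (forall u, U u -> disjoint_elts u y) -> y = 0.
Proof.
move=> dT [[UP Udisj] Umax] y yU; apply: contrapT => yn0.
have [|v [v0 vy vn0 Tv]] := norm_bounded_below dT (modulus_ge0 y).
  by move/modulus_eq0.
have vU u : U u -> disjoint_elts u v.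
  move=> /yU; apply: disjoint_elts_mono; first exact: rle_refl.
  by rewrite modulus_id.
have Uv : U v.
  suff <- : U `|` [set v] = U by right.
  apply: Umax; last by move=> x; left.
  split=> [u [/UP //|-> //]|u w [Uu|->] [Uw|->] // uw].
  - exact: Udisj.
  - exact: vU.
  - exact/disjoint_eltsC/vU.
exact/vn0/disjoint_elts_self/vU.
Qed.

(** The elements of [I] between 0 and [x] are directed upwards by joins, and [x - z] decreases to 0
    along them, so order continuity makes its norm small. *)
Lemma order_dense_ideal_dense_pos E (I : set E) (x : E) (e : K) :
  order_continuous_norm E -> is_ideal I ->
  (forall y, (forall u, I u -> disjoint_elts u y) -> y = 0) ->
  0 <=v x -> 0 < e -> exists z, [/\ I z, 0 <=v z, z <=v x & `|x - z| < e].
Proof.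
move=> oE [I0 ID IS] Idense x0 e0.
pose A := {z : E | [/\ I z, 0 <=v z & z <=v x]}.
pose le (z w : A) := sval z <=v sval w.
have [||[z [Iz z0 zx]]] := oE A le (fun z => x - sval z) _ _ e e0.
- split.
  + by exists (exist _ 0 (And3 I0 (rle_refl _) x0)).
  + by move=> z; exact: rle_refl.
  + by move=> a b c; exact: rle_trans.
  + move=> [z [Iz z0 zx]] [w [Iw w0 wx]].
    have j0 : 0 <=v riesz_join z w by exact: rle_trans z0 (rleUl _ _).
    have Ij : I (riesz_join z w).
      apply: IS (ID 1 z w Iz Iw); rewrite scale1r.
      rewrite !modulus_id //; last exact: raddr_ge0.
      apply: rlub; first exact: rler_wpDr (rle_refl _).
      by rewrite addrC; exact: rler_wpDr (rle_refl _).
    by exists (exist _ (riesz_join z w) (And3 Ij j0 (rlub zx wx)));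
      [exact: rleUl|exact: rleUr].
- split.
  + by move=> a b ab; rewrite rleBlDr addrC -rleBlDr opprB addrC subrK.
  + by move=> [z [Iz z0 zx]] /=; rewrite rsubr_ge0.
  + move=> y yx.
    (* For a lower bound [y] of all [x - z], order density reduces the claim to disjointness of its
       positive part from [I]. *)
    suff py0 : pospart y = 0 by rewrite -py0; exact: pospart_ler.
    apply: Idense => u Iu; set w := pospart y.
    have wle z : I z -> 0 <=v z -> z <=v x -> w <=v x - z.
      move=> Iz z0 zx; apply: rlub; last by rewrite rsubr_ge0.
      exact: (yx (exist _ z (And3 Iz z0 zx))).
    pose p := riesz_meet (modulus u) (modulus w).
    have p0 : 0 <=v p by apply: rmeet_ge0; exact: modulus_ge0.
    have Ip : I p by apply: IS Iu; rewrite modulus_id // rleIl.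
    have pw : p <=v w.
      have : p <=v modulus w by exact: rleIr.
      by rewrite (@modulus_id _ _ w) // pospart_ge0.
    (* If [n%:R *: p] is admissible as [z], then [p <=v w <=v x - n%:R *: p], which leaves space for
       one more copy of [p]. *)
    have pn n : I (n%:R *: p) /\ n%:R *: p <=v x.
      elim: n => [|n [Inp npx]]; first by rewrite scale0r.
      have np0 : 0 <=v n%:R *: p by exact: rscale_ge0.
      rewrite -natr1 scalerDl scale1r; split.
        by rewrite -[n%:R *: p]addr0 -addrA add0r; exact: ID.
      by rewrite addrC -rleBrDr; exact: rle_trans pw (wle _ Inp np0 npx).
    (* All multiples of [p] stay below [x], so their norms are bounded; a nonzero [p] is refuted by
       a multiple beyond the ratio of the norms. *)
    apply/eqP; rewrite -[_ == _]negbK -normr_gt0; apply/negP => np.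
    have := truncnS_gt (`|x| / `|p|); rewrite ltr_pdivrMr // ltNge => /negP; apply.
    have [_ px] := pn (Num.truncn (`|x| / `|p|)).+1.
    have := norm_mono (rscale_ge0 (ler0n K _) p0) px.
    by rewrite normrZ ger0_norm.
- move=> /(_ _ (rle_refl _)) /= xz.
  by exists z.
Qed.

(** Positive and negative parts are approximated separately. The bound by [modulus x] makes
    approximants of disjoint elements disjoint. *)
Lemma order_dense_ideal_dense E (I : set E) (x : E) (e : K) :
  order_continuous_norm E -> is_ideal I ->
  (forall y, (forall u, I u -> disjoint_elts u y) -> y = 0) ->
  0 < e -> exists z, [/\ I z, modulus z <=v modulus x & `|x - z| < e].
Proof.
move=> oE II Idense e0; have e2 : 0 < e / 2 by rewrite divr_gt0.
have [z [Iz z0 zx ze]] := order_dense_ideal_dense_pos oE II Idense (pospart_ge0 x) e2.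
have [w [Iw w0 wx we]] := order_dense_ideal_dense_pos oE II Idense (pospart_ge0 (- x)) e2.
have [_ ID _] := II.
exists (z - w); split.
- by rewrite addrC -scaleN1r; exact: ID.
- apply: modulus_le.
    rewrite rleBlDr; apply: rler_wpDr => //; exact: rle_trans zx (pospart_le_modulus x).
  rewrite opprB rleBlDr; apply: rler_wpDr => //; rewrite -modulusN.
  exact: rle_trans wx (pospart_le_modulus (- x)).
- have -> : x - (z - w) = (pospart x - z) - (pospart (- x) - w).
    by rewrite -{1}(pospartBN x) !opprB [w - z]addrC addrACA [- _ + w]addrC.
  apply: le_lt_trans (ler_normB _ _) _; lra.
Qed.

End IdealsOfBanachLattices.

(** * The bounded and singular parts, and their uniqueness *)

Theorem corollary3p5 (K : realType) (E F : banachLatticeType K)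
    (hE : order_continuous_norm E)
    (T : {linear E -> F}) (hT : disjointness_preserving T)
    (U : set E) (hU : maximal_disjoint_bounded_family T U) :
  exists R S : {linear E -> F},
    bounded_singular_decomposition T (generated_ideal U) R S /\
    (forall R' S' : {linear E -> F},
       bounded_singular_decomposition T (generated_ideal U) R' S' ->
       R' =1 R /\ S' =1 S).
Proof.
have [dU _] := hU.
set ET := generated_ideal U.
have IET : is_ideal ET := generated_ideal_is_ideal U.
have [ET0 ETD ETS] := IET.
have [M M0 TM] : exists2 M : K, 0 < M & forall x, ET x -> `|T x| <= M * `|x|.
  have [M TM] := norm_bounded_generated_ideal hT dU.
  (* The maximum with 1 makes the constant positive, as [bounded_extension] requires. *)
  exists (Num.max M 1); first by rewrite lt_max ltr01 orbT.
  by move=> x /TM/le_trans; apply; rewrite ler_wpM2r // le_max lexx.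
have dense x (e : K) : 0 < e ->
    exists z, [/\ ET z, modulus z <=v modulus x & `|x - z| < e].
  apply: order_dense_ideal_dense => // y yET.
  apply: (maximal_family_order_dense hT hU) => u Uu.
  by apply: yET; exact: sub_generated_ideal.
have [R RT] : exists R : {linear E -> F}, forall x z, ET z ->
    `|R x - T z| <= M * `|x - z|.
  apply: bounded_extension => // x e /(dense x)[z [Iz _ xz]]; by exists z.
have RTE x : ET x -> R x = T x.
  move=> Ex; apply/eqP; rewrite -subr_eq0 -normr_le0.
  by have := RT x x Ex; rewrite subrr normr0 mulr0.
have eM (e : K) : 0 < e -> 0 < e / M by move=> e0; rewrite divr_gt0.
have approx x (e : K) : 0 < e -> exists z,
    [/\ ET z, modulus z <=v modulus x & `|R x - T z| <= e].
  move=> /eM/(dense x)[z [Ez zx xz]]; exists z; split=> //.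
  by apply: le_trans (RT _ _ Ez) _; rewrite mulrC -ler_pdivlMr // ltW.
have dR : disjointness_preserving R.
  move=> x y xy; apply: disjoint_elts_closed => e e0.
  have [z [_ zx xz]] := approx x _ e0; have [w [_ wy yw]] := approx y _ e0.
  by exists (T z), (T w); split=> //; apply/hT/(disjoint_elts_mono zx wy).
(* [T] need not be continuous, yet [T (x - z)] approximates [T x - R x], the error being [R x - T z]
   up to sign; [x - z] and [y - w] remain disjoint because [z] and [w] are dominated by [x] and
   [y]. *)
have dS : disjointness_preserving (fun x => T x - R x).
  move=> x y xy; apply: disjoint_elts_closed => e e0.
  have [z [_ zx xz]] := approx x _ e0; have [w [_ wy yw]] := approx y _ e0.
  have sub a b : T a - R a - T (a - b) = - (R a - T b).
    by rewrite linearB opprB addrC addrA subrK opprB.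
  exists (T (x - z)), (T (y - w)); split; rewrite ?sub ?normrN //.
  apply: hT; apply: disjoint_eltsD.
    apply/disjoint_eltsC/disjoint_eltsD; first exact: disjoint_eltsC.
    apply/disjoint_eltsN/(disjoint_elts_mono wy (rle_refl _)).
    exact: disjoint_eltsC.
  apply/disjoint_eltsN/(disjoint_elts_mono zx (rle_refl _)).
  apply/disjoint_eltsC/disjoint_eltsD; first exact: disjoint_eltsC.
  apply/disjoint_eltsN/(disjoint_elts_mono wy (rle_refl _)).
  exact: disjoint_eltsC.
exists R, (T \- R); split.
  split=> //.
  - by move=> x /=; rewrite addrC subrK.
  - split=> //; exists M => x _.
    by have := RT x 0 ET0; rewrite linear0 !subr0.
  - by move=> x /RTE /= ->; rewrite subrr.
move=> R' S' [TRS [[N RN] _] R'T _ _].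
(* For [z] in [ET], [R' z = T z], so [R' x] and [R x] differ by at most [|N| + M] times the distance
   from [x] to [z], which density makes small. *)
have R'R x : R' x = R x.
  apply/eqP; rewrite -subr_eq0; apply/eqP/norm_le_eq0 => e e0.
  have c0 : 0 < `|N| + M by rewrite ltr_wpDl.
  have [z [Ez _ xz]] := dense x _ (divr_gt0 e0 c0).
  have -> : R' x - R x = R' (x - z) - (R x - T z).
    by rewrite linearB (R'T _ Ez) opprB addrA subrK.
  apply: le_trans (ler_normB _ _) _.
  have h1 := RN (x - z) I; have h2 := RT x _ Ez.
  have h3 : N * `|x - z| <= `|N| * `|x - z| by rewrite ler_wpM2r // ler_norm.
  rewrite ltr_pdivlMr // in xz; lra.
split=> // x /=.
by rewrite -[S' x](addKr (R' x)) -TRS R'R addrC.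
Qed.
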